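(* For every $k\ge 1$, the $k$-cube $Q_k$ is $k$-representable.
   Context: For a word $w$ over an alphabet $A$, two distinct letters $x,y\in A$ alternate in $w$ if deleting all letters other than $x,y$ from $w$ leaves a word of the form $xyxy\cdots$ or $yxyx\cdots$ (of even or odd length). A word $w$ over the alphabet $V$ represents a (finite, simple, undirected) graph $G=(V,E)$ if for all distinct $x,y\in V$: $(x,y)\in E$ if and only if $x$ and $y$ alternate in $w$. A word over $V$ is $k$-uniform if every letter of $V$ occurs exactly $k$ times in it. A graph is $k$-representable if some $k$-uniform word over its node set represents it. The $k$-cube $Q_k$ is the graph whose nodes are the $2^k$ Boolean vectors of length $k$, two nodes being adjacent if and only if they differ in exactly one position. *)

(* Defs.v *)
From mathcomp Require Import all_boot.

Set Implicit Arguments.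
Unset Strict Implicit.
Unset Printing Implicit Defensive.

Record sgraph := SGraph {
  node :> finType;
  adj : rel node;
  adj_sym : symmetric adj;
  adj_irrefl : irreflexive adj
}.

Section Words.
Variable A : eqType.
Implicit Types (x y : A) (w : seq A).

(* The word x y x y ..., truncated to length n (n may be odd). *)
Definition alt_word x y (n : nat) : seq A :=
  mkseq (fun i => if odd i then y else x) n.

Definition alternate w x y : Prop :=
  exists n, [seq z <- w | z \in [:: x; y]] = alt_word x y n \/
            [seq z <- w | z \in [:: x; y]] = alt_word y x n.

Definition uniform_word (k : nat) w : Prop := forall x, count_mem x w = k.

End Words.

Definition represents (G : sgraph) (w : seq G) : Prop :=
  forall x y : G, x != y -> (adj x y <-> alternate w x y).

Definition representable (k : nat) (G : sgraph) : Prop :=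
  exists w : seq G, uniform_word k w /\ represents w.

Section Cube.
Variable k : nat.

Definition cube_adj : rel (k.-tuple bool) :=
  fun u v => #|[set i : 'I_k | tnth u i != tnth v i]| == 1.

Lemma cube_adj_sym : symmetric cube_adj.
Proof.
move=> u v; rewrite /cube_adj; congr (_ == 1).
by apply: eq_card => i; rewrite !inE eq_sym.
Qed.

Lemma cube_adj_irrefl : irreflexive cube_adj.
Proof.
move=> u; rewrite /cube_adj (_ : [set i | _] = set0) ?cards0 //.
by apply/setP => i; rewrite !inE eqxx.
Qed.

Definition cube : sgraph := SGraph cube_adj_sym cube_adj_irrefl.

End Cube.

(* Main.v *)
Require Import Defs.
From mathcomp Require Import all_boot.

Set Implicit Arguments.
Unset Strict Implicit.
Unset Printing Implicit Defensive.

(** The word consists of 2k blocks, one for each bit position i < k and each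
    bit value c; block (i, c) lists every vector whose bit i is c, once. As a
    vector belongs to exactly one of (i, false) and (i, true) for each i, the
    word is k-uniform whatever the order of the blocks and the order inside
    the blocks. These two orders decide which pairs alternate.

    Let u <> v and let D be the set of positions where they differ. A block of
    a position in D contains exactly one of u and v; a block of another
    position contains both or none. So, after the first letter has been
    chosen, the letter that is due at a block is known from the parity of the
    number of earlier blocks with position in D ([alternate_cube_word]). The
    pair alternates when both kinds of blocks agree with this: the single
    letters are the due ones, and the shared blocks start with the due letter.

    Edges. If D = {j}, shared blocks are in agreement as soon as a block b
    lists first the vectors whose bit j is the parity of the number of j-blocks
    before b, among vectors that differ in bit j only. This requirement, for
    all j at once, only says that the order of block b extends a product order
    of the cube, and every lexicographic order, with any priority among the
    positions, does so ([cube_edge_alternates]).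

    Non-edges. Let |D| > 1. Take the blocks in the order (0,false), ...,
    (k-1,false), (0,true), ..., (k-1,true), in which the blocks of two
    distinct positions always separate each other. If u and v alternate, the
    single letters force |D| to be odd. If some position is outside D, walk
    around the cycle to find i outside D with i+1 in D, and look at the block
    of i that contains u and v. The next element of D is i+1, and bit i+1 would
    order u and v in the due way; but the priority of that block
    puts i+1 last, so that the decisive position is the next element e of D
    after i+1. Exactly one single letter, that of i+1, stands between, so bit
    e orders u and v in the wrong way ([successor_clash]).

    This leaves the case where D is everything, which requires k odd. There
    the pair 0101...0, 1010...1 really alternates. So for odd k > 1 the two
    consecutive blocks (k-1,false) and (0,true) are exchanged. Then the
    single letters exclude every D that contains 0, k-1 and another position,
    and D = {0, k-1} is excluded by the blocks of position k-2, the priorities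
    being adapted to that purpose ([two_differences_clash]). For k = 1 there is
    no non-edge. *)

(** * Alternation as the run of a two-state automaton *)

Section AlternateAutomaton.
Variable A : eqType.
Implicit Types (x y : A) (s : seq A).

Fixpoint altb x y s : bool :=
  if s is z :: s' then (z == x) && altb y x s' else true.

Lemma alt_wordS x y n : alt_word x y n.+1 = x :: alt_word y x n.
Proof.
rewrite /alt_word /mkseq /= -add1n iotaDl -map_comp; congr (_ :: _).
by apply: eq_map => i /=; case: (odd i).
Qed.

Lemma altbP x y s : reflect (exists n, s = alt_word x y n) (altb x y s).
Proof.
elim: s x y => [|z s IHs] x y /=; first by left; exists 0.
apply: (iffP andP) => [[/eqP-> alt_s] | [[|n]]].
- by have [n ->] := IHs _ _ alt_s; exists n.+1; rewrite alt_wordS.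
- by [].
- by rewrite alt_wordS => -[-> Ds]; split=> //; apply/IHs; exists n.
Qed.

Lemma alternateP w x y :
  alternate w x y <->
  exists t : bool, altb (if t then y else x) (if t then x else y)
                        [seq z <- w | z \in [:: x; y]].
Proof.
split=> [[n [] Dw] | [[] /altbP[n Dw]]].
- by exists false; apply/altbP; exists n.
- by exists true; apply/altbP; exists n.
- by exists n; right.
- by exists n; left.
Qed.
End AlternateAutomaton.

(** * Lexicographic orders on bit vectors *)

Section Lexicographic.
Variable first : nat -> bool.
Implicit Types (s : seq nat) (u v : seq bool) (e : nat).

(** The positions in [s] are compared from left to right; at the first one where
    the vectors differ, the vector whose bit is [first j] is the smaller. Each
    position thus has its own order on the bits. *)
Fixpoint lexle s u v : bool :=
  if s is j :: s' then
    if nth false u j == nth false v j then lexle s' u v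
    else nth false u j == first j
  else true.

Lemma lexle_total s : total (lexle s).
Proof.
by elim: s => //= j s IHs u v; rewrite eq_sym; case: eqP => // ;
   case: (nth _ u j) (nth _ v j) (first j) => [] [] [].
Qed.

Lemma lexle_trans s : transitive (lexle s).
Proof.
elim: s => //= j s IHs v u w.
by case: (nth _ u j) (nth _ v j) (nth _ w j) (first j) => [] [] [] [] //=; exact: IHs.
Qed.

Lemma lexle_cat s1 s2 u v :
  {in s1, forall j, nth false u j = nth false v j} ->
  lexle (s1 ++ s2) u v = lexle s2 u v.
Proof.
elim: s1 => //= j s1 IHs eq_uv; rewrite eq_uv ?mem_head // eqxx IHs // => l s1l.
by rewrite eq_uv // inE s1l orbT.
Qed.

Lemma lexle_first s1 e s2 u v :
  {in s1, forall j, nth false u j = nth false v j} ->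
  nth false u e != nth false v e ->
  lexle (s1 ++ e :: s2) u v = (nth false u e == first e).
Proof. by move=> eq_uv /negPf ne_uv; rewrite lexle_cat //= ne_uv. Qed.

Lemma lexle_decided s u v :
  has (fun j => nth false u j != nth false v j) s ->
  exists e, [/\ e \in s, nth false u e != nth false v e &
             lexle s u v = (nth false u e == first e)].
Proof.
elim: s => //= j s IHs; case: eqP => [_ /IHs[e [se ne_e ->]]|/eqP ne_j _].
  by exists e; rewrite inE se orbT.
by exists j; rewrite mem_head.
Qed.

Lemma lexle_antisym s u v :
  has (fun j => nth false u j != nth false v j) s -> lexle s v u = ~~ lexle s u v.
Proof.
elim: s => //= j s IHs; rewrite [_ v j == _]eq_sym; case: eqP => //= ne_j _.
by case: (nth _ u j) (nth _ v j) (first j) ne_j => [] [] [].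
Qed.

(** Rotating the positions by [c.+1] gives the priority order that starts just
    after [c], goes around, and ends with [c]: this lemma and the next one find
    the decisive position on either side of the wrap. *)
Lemma lexle_rot_after k c e u v : c < e < k ->
  (forall j, c < j < e -> nth false u j = nth false v j) ->
  nth false u e != nth false v e ->
  lexle (rot c.+1 (iota 0 k)) u v = (nth false u e == first e).
Proof.
case/andP=> lt_ce lt_ek eq_uv ne_e.
have ->: rot c.+1 (iota 0 k) =
   iota c.+1 (e - c.+1) ++ e :: (iota e.+1 (k - e.+1) ++ iota 0 c.+1).
  rewrite /rot drop_iota take_iota add0n (minn_idPl (leq_trans lt_ce (ltnW lt_ek))).
  rewrite [k - c.+1](_ : _ = e - c.+1 + (k - e.+1).+1).
    by rewrite iotaD subnKC //= -catA.
  by rewrite subnSK // addnC addnBA // subnK // ltnW.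
apply: lexle_first => // j; rewrite mem_iota subnKC // => j_int; exact: eq_uv.
Qed.

Lemma lexle_rot_wrap k c e u v : e <= c < k ->
  (forall j, c < j < k -> nth false u j = nth false v j) ->
  (forall j, j < e -> nth false u j = nth false v j) ->
  nth false u e != nth false v e ->
  lexle (rot c.+1 (iota 0 k)) u v = (nth false u e == first e).
Proof.
case/andP=> le_ec lt_ck eq_hi eq_lo ne_e.
have ->: rot c.+1 (iota 0 k) =
   (iota c.+1 (k - c.+1) ++ iota 0 e) ++ e :: iota e.+1 (c - e).
  rewrite /rot drop_iota take_iota add0n (minn_idPl lt_ck) -catA; congr (_ ++ _).
  by rewrite -[c.+1](subnKC (leqW le_ec)) iotaD add0n subSn.
apply: lexle_first => // j; rewrite mem_cat !mem_iota subnKC // add0n.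
by case/orP=> [/eq_hi|/eq_lo].
Qed.
End Lexicographic.

(** * The block word of an arrangement *)

Definition parity (d : nat -> bool) (bs : seq (nat * bool)) : bool :=
  \big[addb/false]_(b <- bs) d b.1.

Definition before d bs b : bool := parity d (take (index b bs) bs).

Definition differ (u v : seq bool) (i : nat) : bool :=
  nth false u i != nth false v i.

Lemma perm_pair (T : eqType) (x y : T) s :
  perm_eq s [:: x; y] -> s = [:: x; y] \/ s = [:: y; x].
Proof.
case: s => [/perm_size //|z s] perm_s.
have: z \in [:: x; y] by rewrite -(perm_mem perm_s) mem_head.
rewrite !inE => /orP[]/eqP Dz; move: perm_s; rewrite {z}Dz.
  by rewrite perm_cons => /perm_small_eq->; [left|].
by rewrite -[[:: x; y]]/([:: x] ++ [:: y]) perm_sym perm_catC /= perm_cons perm_sym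
   => /perm_small_eq->; [right|].
Qed.

Lemma before_split d s1 b s2 :
  uniq (s1 ++ b :: s2) -> before d (s1 ++ b :: s2) b = parity d s1.
Proof.
rewrite /before cat_uniq /= negb_or => /and3P[_ /andP[s1'b _] _].
by rewrite index_cat (negPf s1'b) /= eqxx addn0 take_size_cat.
Qed.

Section CubeWord.
Variables (k : nat) (bs : seq (nat * bool)) (prio : nat * bool -> seq nat).
Implicit Types (u v : k.-tuple bool) (b : nat * bool).

(** Bit [before (pred1 j) bs b] is what alternation asks in block [b] from two
    vectors that differ at [j] only and meet their first single letter at the
    block (j, false): the one with that bit is due first. *)
Definition block_le b : rel (k.-tuple bool) :=
  fun u v => lexle (fun j => before (pred1 j) bs b) (prio b) u v.

Definition block b : seq (k.-tuple bool) :=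
  sort (block_le b) [seq u : k.-tuple bool <- enum {: k.-tuple bool} |
                       nth false u b.1 == b.2].

Definition cube_word : seq (k.-tuple bool) := flatten [seq block b | b <- bs].

Lemma block_uniq b : uniq (block b).
Proof. by rewrite sort_uniq; apply: filter_uniq (enum_uniq _). Qed.

Lemma count_cube_word u :
  count_mem u cube_word = count (fun b => nth false u b.1 == b.2) bs.
Proof.
rewrite /cube_word count_flatten -map_comp -sumn_count.
congr (sumn _); apply: eq_map => b /=.
by rewrite (count_uniq_mem _ (block_uniq b)) mem_sort mem_filter mem_enum andbT.
Qed.

Hypothesis prio_full : forall b, {subset iota 0 k <= prio b}.

Lemma differ_has u v b : u != v -> has (differ u v) (prio b).
Proof.
move=> ne_uv; apply/hasP; case: (pickP (fun i => tnth u i != tnth v i)) => [i ne_i|eq_uv].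
  exists (i : nat); first by rewrite prio_full // mem_iota ltn_ord.
  by rewrite /differ -!tnth_nth.
by case/eqP: ne_uv; apply: eq_from_tnth => i; move/eqP: (eq_uv i).
Qed.

Lemma block_le_antisym u v b : u != v -> block_le b v u = ~~ block_le b u v.
Proof. by move=> ne_uv; apply/lexle_antisym/differ_has. Qed.

Lemma filter_block u v b : u != v ->
  [seq z <- block b | z \in [:: u; v]] =
  if differ u v b.1 then [:: if nth false u b.1 == b.2 then u else v]
  else if nth false u b.1 != b.2 then [::]
  else if block_le b u v then [:: u; v] else [:: v; u].
Proof.
move=> ne_uv.
rewrite /block filter_sort; [|exact: lexle_total|by move=> v' u' w; apply: lexle_trans].
set s := filter _ _; set p := fun z : k.-tuple bool => nth false z b.1 == b.2.
have perm_s: perm_eq s (filter p [:: u; v]).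
  apply: uniq_perm => [||z].
  - by apply: filter_uniq; apply: filter_uniq (enum_uniq _).
  - by apply: filter_uniq; rewrite /= inE ne_uv.
  by rewrite [in RHS]mem_filter mem_filter [in LHS]mem_filter mem_enum andbT andbC.
move: perm_s; rewrite /= /p /differ.
case: (boolP (nth false u b.1 == b.2)) => u_b;
  case: (boolP (nth false v b.1 == b.2)) => v_b.
- rewrite (eqP u_b) (eqP v_b) eqxx /= => /perm_pair[]->; rewrite /sort /=.
    by case: block_le.
  by rewrite block_le_antisym //; case: block_le.
- by move/perm_small_eq->; rewrite // (eqP u_b) eq_sym v_b.
- by move/perm_small_eq->; rewrite // (eqP v_b) u_b.
- by move/perm_small_eq->; rewrite // (_ : nth false u _ = nth false v b.1) ?eqxx //;
   case: (nth _ u _) (nth _ v _) b.2 u_b v_b => [] [] [].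
Qed.

(** Here [t] tells whether [v] is the letter due when block [b] begins. *)
Definition fits u v t b : bool :=
  if differ u v b.1 then t == (nth false u b.1 != b.2)
  else (nth false u b.1 == b.2) ==> (t == ~~ block_le b u v).

Lemma altb_blocks u v (t : bool) s : u != v ->
  altb (if t then v else u) (if t then u else v)
       [seq z <- flatten [seq block b | b <- s] | z \in [:: u; v]] <->
  forall s1 b s2, s = s1 ++ b :: s2 ->
    fits u v (t (+) parity (differ u v) s1) b.
Proof.
move=> ne_uv; elim: s t => [|b s IHs] t /=.
  by split=> // _ [].
have fits_cons: (fits u v t b /\ forall s1 b' s2, s = s1 ++ b' :: s2 ->
    fits u v (t (+) differ u v b.1 (+) parity (differ u v) s1) b') <->
    forall s1 b' s2, b :: s = s1 ++ b' :: s2 -> fits u v (t (+) parity (differ u v) s1) b'.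
  split=> [[fit_b fit_s] [|b1 s1] b' s2 /= | fit].
  - by case=> <- _; rewrite /parity big_nil addbF.
  - by case=> <- /fit_s; rewrite /parity big_cons addbA.
  split=> [|s1 b' s2 Ds]; first by have:= fit [::] b s erefl; rewrite /parity big_nil addbF.
  by have:= fit (b :: s1) b' s2; rewrite /parity big_cons addbA; apply; rewrite Ds.
apply: iff_trans fits_cons.
apply: iff_trans (and_iff_compat_l _ (IHs (t (+) differ u v b.1))).
rewrite filter_cat filter_block // /fits; have ne_vu: v != u by rewrite eq_sym.
case: (differ u v b.1); case: (nth _ u _ == _); case: (block_le b u v); case: t => /=;
  rewrite ?eqxx ?(negPf ne_uv) ?(negPf ne_vu) /=;
  by split=> [|[]].
Qed.

(** A shared block does not change the letter that is due, and a block of a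
    position where the vectors differ always does; hence the letter due at [b]
    is the initial one corrected by [before]. *)
Lemma alternate_cube_word u v : uniq bs -> u != v ->
  alternate cube_word u v <->
  exists t, forall b, b \in bs -> fits u v (t (+) before (differ u v) bs b) b.
Proof.
move=> uniq_bs ne_uv; apply: iff_trans (alternateP _ _ _) _.
split=> -[t alt_t]; exists t.
  move=> b bs_b; move/(altb_blocks t _ ne_uv): alt_t; apply.
  by rewrite -[LHS](cat_take_drop (index b bs)) (drop_nth b) ?index_mem // nth_index.
apply/(altb_blocks t _ ne_uv) => s1 b s2 Dbs; rewrite Dbs in uniq_bs alt_t.
by rewrite -(before_split _ uniq_bs) alt_t // mem_cat mem_head orbT.
Qed.

(** When the vectors differ at [j] only, the decisive position of a shared block
    can only be [j], and there the order was chosen to follow alternation. *)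
Lemma cube_edge_alternates u v j : uniq bs ->
  {in bs, forall b, b.1 < k} ->
  (forall c, (j, c) \in bs -> before (pred1 j) bs (j, c) = c) ->
  j < k -> (forall i, i < k -> differ u v i = (i == j)) ->
  alternate cube_word u v.
Proof.
move=> uniq_bs bs_k bs_j lt_jk d_uv.
have ne_j: differ u v j by rewrite d_uv ?eqxx.
have ne_uv: u != v by apply: contraNneq ne_j => ->; rewrite /differ eqxx.
apply/alternate_cube_word => //; exists (nth false u j) => -[i c] bs_b.
have ->: before (differ u v) bs (i, c) = before (pred1 j) bs (i, c).
  by apply: eq_big_seq => b /mem_take/bs_k/d_uv.
rewrite /fits /= d_uv ?(bs_k _ bs_b) //; case: eqVneq => [Di | _].
  by move: bs_b; rewrite Di => /bs_j->; case: nth; case: c.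
apply/implyP => _; rewrite /block_le.
have [e [_ ne_e ->]] :=
  lexle_decided (fun l => before (pred1 l) bs (i, c)) (differ_has (i, c) ne_uv).
have lt_ek: e < k.
  by rewrite ltnNge; apply: contraNN ne_e => le_ke; rewrite !nth_default ?size_tuple.
have: differ u v e by []; rewrite d_uv // => /eqP->.
by case: nth; case: before.
Qed.
End CubeWord.

(** * The arrangement of the blocks and the priorities *)

Section Arrangement.
Variable n : nat.

(** The dimension is [n.+2]. For odd [n] two neighbouring blocks are exchanged,
    which spoils the alternation of the vectors 0101...0 and 1010...1. *)
Definition arrangement : seq (nat * bool) :=
  [seq (i, false) | i <- iota 0 n.+1] ++
  (if odd n then [:: (0, true); (n.+1, false)] else [:: (n.+1, false); (0, true)]) ++
  [seq (i, true) | i <- iota 1 n.+1].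

(** The position of lowest priority in a block, normally the cyclic successor
    of the position of the block. When [n] is odd there are two exceptions. In
    block (n+1, false) it is 1, because (0, true) has been moved before this
    block and (1, true) is what follows it. In block (n, false) it is 0, so that
    position n+1 outranks 0 there, while 0 outranks n+1 in block (n, true). *)
Definition pivot (b : nat * bool) : nat :=
  let: (i, c) := b in
  if [&& odd n, ~~ c & n <= i] then nat_of_bool (i == n.+1)
  else if i == n.+1 then 0 else i.+1.

Definition priority (b : nat * bool) : seq nat := rot (pivot b).+1 (iota 0 n.+2).

Definition parity_below (d : nat -> bool) m : bool := \big[addb/false]_(i <- iota 0 m) d i.

Lemma mem_arrangement i c : ((i, c) \in arrangement) = (i < n.+2).
Proof.
have inj (b : bool) : injective (fun i : nat => (i, b)) by move=> ? ? [].
rewrite /arrangement !mem_cat.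
have mem_pair (b : bool) s :
    ((i, c) \in [seq (l, b) | l <- s]) = (c == b) && (i \in s).
  case: (eqVneq c b) => [->|ne_cb]; first by rewrite (mem_map (inj b)).
  by apply/negbTE/mapP => -[l _ [_ Dc]]; rewrite Dc eqxx in ne_cb.
have ->: ((i, c) \in if odd n then [:: (0, true); (n.+1, false)]
      else [:: (n.+1, false); (0, true)]) = (if c then i == 0 else i == n.+1).
  by case: ifP => _; rewrite !inE !xpair_eqE; case: (c); rewrite /= ?andbT ?andbF ?orbF.
by rewrite !mem_pair !mem_iota add0n add1n; case: (c); case: (i) => [|i'] //=;
   rewrite ?ltnS // [RHS]leq_eqVlt orbF orbC.
Qed.

Lemma uniq_all_blocks :
  uniq [seq (i, c) | i <- iota 0 n.+2, c <- [:: false; true]].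
Proof. by apply: allpairs_uniq; rewrite ?iota_uniq // => -[i c] [i' c'] _ _ [-> ->]. Qed.

Lemma perm_arrangement :
  perm_eq [seq (i, c) | i <- iota 0 n.+2, c <- [:: false; true]] arrangement.
Proof.
have := uniq_all_blocks; set s := (X in uniq X) => uniq_s.
have sub_s: {subset s <= arrangement}.
  by move=> _ /allpairsP[[i c] [Hi _ ->]]; rewrite mem_iota in Hi; rewrite mem_arrangement.
have size_s: size arrangement <= size s.
  rewrite size_allpairs size_iota /arrangement !size_cat !size_map !size_iota.
  by case: ifP => _ /=; rewrite muln2 -addnn !addnS !addSn.
apply: uniq_perm => //; first exact: leq_size_uniq uniq_s sub_s size_s.
by case: (uniq_min_size uniq_s sub_s size_s).
Qed.

Lemma uniq_arrangement : uniq arrangement.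
Proof. by rewrite -(perm_uniq perm_arrangement) uniq_all_blocks. Qed.

Lemma count_arrangement (p : nat -> bool) :
  count (fun b => p b.1 == b.2) arrangement = n.+2.
Proof.
rewrite -(permP perm_arrangement) -[RHS](size_iota 0).
by elim: (iota 0 _) => //= i s ->; case: (p i).
Qed.

Lemma parity_map d c s : parity d [seq (i, c) | i <- s] = \big[addb/false]_(i <- s) d i.
Proof. by rewrite /parity big_map. Qed.

Lemma parity_cat d s1 s2 : parity d (s1 ++ s2) = parity d s1 (+) parity d s2.
Proof. exact: big_cat. Qed.

Lemma parity_below_cat d i m : i <= m ->
  parity_below d m = parity_below d i (+) \big[addb/false]_(j <- iota i (m - i)) d j.
Proof. by move=> le_im; rewrite /parity_below -{1}(subnKC le_im) iotaD big_cat. Qed.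

Lemma parity_belowS d m : parity_below d m.+1 = parity_below d m (+) d m.
Proof. by rewrite (parity_below_cat _ (leqnSn m)) subSnn big_seq1. Qed.

Lemma parity_below1 d : parity_below d 1 = d 0.
Proof. exact: big_seq1. Qed.

(** The last summand is the effect of the exchange of (n+1, false) and
    (0, true): each of them sees the other one appear or disappear before it. *)
Lemma beforeE d i c : i < n.+2 ->
  before d arrangement (i, c) =
  parity_below d i (+) (c && parity_below d n.+2) (+)
  (odd n && (if c then (i == 0) && d n.+1 else (i == n.+1) && d 0)).
Proof.
move=> lt_i.
(* It is enough to exhibit the blocks s1 that stand before (i, c). *)
suff [s1 [s2 [Ds <-]]]: exists s1 s2, arrangement = s1 ++ (i, c) :: s2 /\
  parity d s1 = parity_below d i (+) (c && parity_below d n.+2) (+)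
  (odd n && (if c then (i == 0) && d n.+1 else (i == n.+1) && d 0)).
  by have:= uniq_arrangement; rewrite Ds => uniq_s; rewrite before_split.
have split_iota a m : a <= i < a + m ->
  [seq (l, c) | l <- iota a m] = [seq (l, c) | l <- iota a (i - a)] ++ (i, c) ::
    [seq (l, c) | l <- iota i.+1 (a + m - i.+1)].
  case/andP=> le_ai lt_im; rewrite -map_cons -map_cat; congr (map _ _).
  have {1}->: m = i - a + (a + m - i.+1).+1.
    by rewrite subnSK // addnC addnBA // subnK ?(ltnW lt_im) // addnC addnK.
  by rewrite iotaD subnKC.
case: c split_iota => split_iota; last first.
  move: lt_i; rewrite ltnS leq_eqVlt andFb addbF => /orP[/eqP Di | lt_in].
    rewrite Di eqxx /arrangement; case: (odd n).
      exists ([seq (l, false) | l <- iota 0 n.+1] ++ [:: (0, true)]); eexists.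
      by split; [rewrite -catA;
        reflexivity | rewrite parity_cat parity_map /parity big_seq1].
    by eexists; eexists; split; [reflexivity | rewrite parity_map addbF].
  eexists; eexists; split.
    by rewrite /arrangement split_iota ?leq0n //; rewrite -catA cat_cons; reflexivity.
  by rewrite parity_map subn0 (ltn_eqF lt_in) andFb andbF addbF.
case: i lt_i split_iota => [|i] lt_i split_iota.
  rewrite /arrangement [parity_below d 0]big_nil addFb andTb eqxx andTb parity_belowS;
    case: (odd n).
    eexists; eexists; split; first reflexivity.
    by rewrite parity_map /= -addbA addbb addbF.
  exists ([seq (l, false) | l <- iota 0 n.+1] ++ [:: (n.+1, false)]); eexists.
  by split; [rewrite -catA;
    reflexivity | rewrite parity_cat parity_map /parity big_seq1 addbF].
rewrite andFb andbF addbF.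
eexists; eexists; split.
  by rewrite /arrangement [X in _ ++ _ ++ X]split_iota // !catA; reflexivity.
rewrite !parity_cat !parity_map -/(parity_below d n.+1) subSS subn0.
have ->: parity_below d i.+1 = d 0 (+) \big[addb/false]_(l <- iota 1 i) d l
  by exact: big_cons.
rewrite andTb [parity_below d n.+2]parity_belowS.
case: ifP => _; rewrite /parity big_cons big_seq1 /=;
  by case: (parity_below d _) (d 0) (d n.+1) (bigop _ _ _) => [] [] [] [].
Qed.
End Arrangement.

Lemma parity_below_none (d : nat -> bool) a m :
  a <= m -> (forall i, a <= i < m -> ~~ d i) -> parity_below d m = parity_below d a.
Proof.
move=> le_am d0; rewrite (parity_below_cat _ le_am) big_seq big1 ?addbF // => i.
by rewrite mem_iota subnKC // => i_am; apply/negbTE/d0.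
Qed.

Lemma parity_below_all (d : nat -> bool) a m : a <= m -> (forall i, a <= i < m -> d i) ->
  parity_below d m = parity_below d a (+) odd (m - a).
Proof.
move=> le_am d1; rewrite (parity_below_cat _ le_am); congr (_ (+) _).
rewrite (eq_big_seq (fun=> true)) => [|i].
  rewrite -[in RHS](size_iota a (m - a)).
  by elim: (iota a _) => [|i s IHs]; rewrite ?big_nil ?big_cons //= IHs.
by rewrite mem_iota subnKC // => i_am; rewrite d1.
Qed.

Lemma parity_below_pred1 j m : parity_below (pred1 j) m = (j < m).
Proof.
elim: m => [|m IHm]; first exact: big_nil.
by rewrite parity_belowS IHm /= ltnS (leq_eqVlt j) [m == j]eq_sym; case: (ltngtP j m).
Qed.

(** * Vectors that differ in two positions do not alternate *)

Section Clash.
Variable n : nat.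
(** [D] stands for the positions where two vectors differ, [U] for the bits of
    one of them. *)
Variables (D U : nat -> bool).

(** Position [e] is the first element of [D] met when going around the cycle
    from [p.+1], with [p] itself coming last: it is the decisive position in a
    block of pivot [p]. *)
Definition leads p e : Prop :=
  D e /\ ((p < e /\ forall j, p < j < e -> ~~ D j) \/
         [/\ e <= p, forall j, p < j < n.+2 -> ~~ D j & forall j, j < e -> ~~ D j]).

Hypothesis D_lt : forall i, D i -> i < n.+2.

Lemma leads_exists p j : D j -> exists e, leads p e.
Proof.
move=> Dj;
  have [/existsP[l /andP[lt_pl Dl]] | /existsPn no_gt] :=
    boolP [exists l : 'I_n.+2, (p < l) && D l].
  have ex_l: exists l, (p < l) && D l by exists (l : nat); rewrite lt_pl.
  case: (ex_minnP ex_l) => e /andP[lt_pe De] min_e; exists e; split=> //; left;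
    split=> // i /andP[lt_pi lt_ie].
  by apply: contraL lt_ie => Di; rewrite -leqNgt min_e ?lt_pi.
have no_D i : p < i -> ~~ D i.
  move=> lt_pi; apply/negP=> Di; have:= no_gt (Ordinal (D_lt Di)).
  by rewrite /= lt_pi Di.
have ex_D: exists l, D l by exists j.
case: (ex_minnP ex_D) => e De min_e; exists e; split=> //; right; split.
- by rewrite leqNgt; apply: contraL De; apply: no_D.
- by move=> i /andP[/no_D].
- by move=> i lt_ie; apply: contraL lt_ie => Di; rewrite -leqNgt min_e.
Qed.

Lemma gap_or_closed a :
  (exists i, [/\ a <= i, i < n.+1, ~~ D i & D i.+1]) \/
  (forall i j, a <= i <= j -> D j -> D i).
Proof.
have [/existsP[i /and3P[le_ai Di DSi]] | /existsPn closed] :=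
  boolP [exists i : 'I_n.+1, [&& a <= i, ~~ D i & D i.+1]].
  by left; exists (i : nat); rewrite ltn_ord.
right=> i j /andP[le_ai]; elim: j => [|j IHj]; first by rewrite leqn0 => /eqP->.
rewrite leq_eqVlt => /orP[/eqP-> // | le_ij DSj]; apply: IHj => //.
have := closed (Ordinal (D_lt DSj : j < n.+1)); rewrite /= DSj (leq_trans le_ai) // andbT.
by rewrite negbK.
Qed.

Local Notation P := (before D (arrangement n)).
Local Notation f e := (before (pred1 e) (arrangement n)).

(** The two hypotheses below are what remains of alternation once the initial
    letter has been eliminated: from the two blocks of a position in [D], and
    from comparing the shared block (i, U i) with the first block of its
    decisive position. *)
Hypothesis singles : forall e, D e -> P (e, true) = ~~ P (e, false).
Hypothesis commons : forall i e, i < n.+2 -> ~~ D i ->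
  leads (pivot n (i, U i)) e -> P (i, U i) = P (e, false) (+) f e (i, U i).

Variables j1 j2 : nat.
Hypotheses (D_j1 : D j1) (D_j2 : D j2) (ne_j : j1 != j2).

Lemma two_bits e : exists2 j, D j & j != e.
Proof. by case: (eqVneq j1 e) ne_j => [<-|ne _]; [exists j2;
  rewrite // eq_sym | exists j1]. Qed.

(** Let [p] be the cyclic successor of [i]. The letter due at block [i] and the
    letter that bit [e] puts first there agree only if an even number of single
    letters stands between block [i] and the next block of [e]. But the only
    one is that of [p]. *)
Lemma successor_clash i : i < n.+2 -> parity_below D n.+2 = true ->
  (forall e, D e -> P (e, false) = parity_below D e) ->
  ~~ D i -> D (if i == n.+1 then 0 else i.+1) ->
  pivot n (i, U i) = (if i == n.+1 then 0 else i.+1) ->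
  P (i, U i) = parity_below D i (+) U i ->
  (forall e, D e -> f e (i, U i) = (e < i) (+) U i) -> False.
Proof.
move=> lt_i par_D P_D Di; set p := if _ then _ else _ => Dp piv P_i f_i.
have [e lead_e] := leads_exists p D_j1; have := commons lt_i Di.
rewrite piv => /(_ e lead_e); case: lead_e => De lead_e.
rewrite P_i P_D // f_i // addbA => /addIb.
have ne_ei: e != i by apply: contraNneq Di => <-.
have par_p: parity_below D p.+1 = ~~ parity_below D p by rewrite parity_belowS Dp addbT.
case: lead_e => [[lt_pe no_D] | [le_ep no_gt no_lt]].
  rewrite (@parity_below_none D p.+1 e) // par_p; move: lt_pe.
  (* Without wrap between i and e, the parities at i and e differ by D p. *)
  rewrite /p; case: (eqVneq i n.+1) => [Di' | _] lt_pe; last first.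
    rewrite parity_belowS (negPf Di) addbF ltnNge (ltnW (ltnW lt_pe)).
    by case: parity_below.
  have ->: parity_below D i = true by move: par_D;
    rewrite parity_belowS -Di' (negPf Di) addbF.
  by rewrite /parity_below big_nil (ltn_neqAle e) ne_ei -ltnS Di' D_lt.
(* Here p is the last element of D and e the first one; e = p would make D a
   singleton. *)
rewrite (@parity_below_none D 0 e) // [parity_below D 0]big_nil.
have lt_ep: e < p.
  rewrite ltn_neqAle le_ep andbT; apply/eqP => De_p; have [j Dj] := two_bits p.
  case: ltngtP => // [lt_jp|lt_pj] _; first by have:= no_lt j;
    rewrite De_p lt_jp Dj => /(_ isT).
  by have:= no_gt j; rewrite lt_pj D_lt // Dj => /(_ isT).
move: par_D; rewrite (@parity_below_none D p.+1 n.+2) ?D_lt // par_p.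
move: lt_ep; rewrite /p; case: (eqVneq i n.+1) => // _ lt_ei.
by rewrite parity_belowS (negPf Di) addbF => /negPf->; rewrite ltn_neqAle ne_ei -ltnS lt_ei.
Qed.

(** The case analysis is about the exchanged blocks. If [n] is odd and [D]
    contains 0 and n+1, the single letters reduce [D] to {0, n+1}, refuted by a
    block of position [n]. Otherwise the single letters occur as if nothing had
    been exchanged, and it remains to find a gap of [D] at a position whose
    blocks and pivot are not affected by the exchange, or to treat by hand the
    blocks with an exceptional pivot. *)
Lemma two_differences_clash : False.
Proof.
have lt0: 0 < n.+2 by []. have lt_n: n.+1 < n.+2 by [].
have Pf e : e < n.+2 -> P (e, false) = parity_below D e (+) [&& odd n, e == n.+1 & D 0].
  by move=> lt_e; rewrite beforeE // andFb addbF.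
have Pt e : e < n.+2 -> P (e, true) =
    parity_below D e (+) parity_below D n.+2 (+) [&& odd n, e == 0 & D n.+1].
  by move=> lt_e; rewrite beforeE.
have ff e i : e < n.+2 -> i < n.+2 ->
    f e (i, false) = (e < i) (+) [&& odd n, i == n.+1 & e == 0].
  by move=> lt_e lt_i; rewrite beforeE // parity_below_pred1 andFb addbF /= [0 == e]eq_sym.
have ft e i : e < n.+2 -> i < n.+2 ->
    f e (i, true) = ~~ (e < i) (+) [&& odd n, i == 0 & e == n.+1].
  by move=> lt_e lt_i; rewrite beforeE // !parity_below_pred1 lt_e addbT /= [_ == e]eq_sym.
have par_lt m : parity_below D m.+1 = parity_below D m (+) D m by apply: parity_belowS.
have par00: parity_below D 0 = false by apply: big_nil.
case: (boolP [&& odd n, D 0 & D n.+1]) => [/and3P[odd_n D0 Dn] | swap].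
  (* The two blocks of 0 force the cardinal of D to be even, while those of an
     element strictly between 0 and n+1 would force it to be odd. *)
  have n_gt0: 0 < n by case: (n) odd_n.
  have par_n2: parity_below D n.+2 = false.
    by move: (singles D0); rewrite Pf // Pt // par00 odd_n Dn; case: parity_below.
  have no_mid j : 0 < j < n.+1 -> ~~ D j.
    case/andP=> j_gt0 lt_j; apply/negP=> Dj; have := singles Dj.
    by rewrite Pf ?D_lt // Pt ?D_lt // par_n2 (gtn_eqF j_gt0) (ltn_eqF lt_j) !andbF !addbF;
      case: parity_below.
  have par_n: parity_below D n = true.
    by rewrite (@parity_below_none D 1) ?parity_below1 // => i /andP[i_gt0 /ltnW lt_i];
      rewrite no_mid // i_gt0.
  have D'n: ~~ D n by rewrite no_mid // n_gt0 /=.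
  have := @commons n; rewrite (ltnW lt_n) => /(_ _ isT D'n).
  case: (U n); rewrite /pivot odd_n leqnn /= ?(ltn_eqF (ltnSn n)).
    move/(_ 0);
      rewrite Pt ?Pf ?ft // par_n par_n2 par00 (gtn_eqF n_gt0) n_gt0 !andbF /= => clash.
    suff /clash: leads n.+1 0 by [].
    split=> //; right; split=> // i /andP[lt_i].
    by rewrite ltnS leqNgt lt_i.
  move/(_ n.+1);
    rewrite Pf // Pf // ff // par_n par_lt par_n (negPf D'n) odd_n D0 eqxx !andbF /=.
  rewrite (ltn_eqF (ltnSn n)) ltnNge leqnSn /= => clash.
  by suff /clash: leads false n.+1 by []; split=> //; left.
(* From here on D does not contain both 0 and n+1 when n is odd. *)
have P_nat e : D e -> P (e, false) = parity_below D e.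
  move=> De; rewrite Pf ?D_lt //; case: eqP swap => [<- | _]; last by rewrite andbF addbF.
  by rewrite De andbT => /negPf->; rewrite addbF.
have par_n2 : parity_below D n.+2 = true.
  have := singles D_j1; rewrite P_nat // Pt ?D_lt //; case: eqP swap => [<- | _].
    by rewrite D_j1 => /negPf->; rewrite addbF; case: (parity_below D j1);
      case: parity_below.
  by rewrite andbF addbF; case: (parity_below D j1); case: parity_below.
(* First case: D contains n+1 but not 0. The blocks of 0 are affected by the
   exchange, so the gap is looked for at positive positions; it exists, since
   otherwise D would have the even cardinal n+1, and par_n2 says it is odd. *)
have [/andP[odd_n Dn] | no_wrap] := boolP (odd n && D n.+1).
  have D'0: ~~ D 0 by move: swap; rewrite odd_n Dn andbT.
  have [[i [i_gt0 lt_i D'i DSi]] | closed] := gap_or_closed 1; last first.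
    move: par_n2; rewrite (@parity_below_all D 1) ?parity_below1 ?(negPf D'0) //= ?odd_n //.
    by move=> i /andP[i_gt0 lt_i]; apply: (closed i n.+1) => //; rewrite i_gt0.
  have lt_i2 := ltnW lt_i.
  (* The exceptional pivot of block (n, false): the decisive position e is then
     the smallest element of D, and the parities force it to be n+1. *)
  have [/andP[/negPf Ui le_ni] | piv] := boolP (~~ U i && (n <= i)).
    have Di: i = n by apply/eqP; rewrite eqn_leq le_ni -ltnS lt_i.
    have [j Dj ne_jn] := two_bits n.+1; have := commons lt_i2 D'i.
    rewrite Ui /pivot odd_n le_ni (ltn_eqF lt_i) /=.
    have [e lead_e] := leads_exists 0 Dj; move/(_ e lead_e).
    case: lead_e => De [[e_gt0 no_D] | []]; last by rewrite leqn0 => /eqP De0;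
      rewrite De0 (negPf D'0) in De.
    rewrite Pf // P_nat // ff // ?D_lt // (ltn_eqF lt_i) andbF addbF.
    rewrite (@parity_below_none D 1 e) // parity_below1 (negPf D'0) /= ?addbF.
    have ->: parity_below D i = false by move: par_n2;
      rewrite !par_lt Di Dn -Di (negPf D'i) addbF addbT; case: parity_below.
    move/esym/negbT; rewrite -leqNgt Di => le_ne.
    have De1: e = n.+1.
      apply/eqP; rewrite eqn_leq -ltnS D_lt //= ltn_neqAle le_ne andbT.
      by apply: contraTneq De => <-; rewrite -Di.
    have lt_jn: j < n.+1 by rewrite ltn_neqAle ne_jn -ltnS D_lt.
    have j_gt0: 0 < j by rewrite lt0n; apply: contraNneq D'0 => <-.
    by have := no_D j; rewrite De1 Dj j_gt0 lt_jn => /(_ isT).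
  apply: (@successor_clash i) => //; rewrite ?(ltn_eqF lt_i) //.
  - rewrite /pivot odd_n (ltn_eqF lt_i) /=; by move: piv => /negPf->.
  - by case: (U i);
      rewrite ?Pt ?Pf // ?par_n2 ?(ltn_eqF lt_i) ?(gtn_eqF i_gt0) !andbF !addbF.
  - move=> e De; case: (U i);
      rewrite ?ft ?ff // ?D_lt // ?(ltn_eqF lt_i) ?(gtn_eqF i_gt0) !andbF !addbF //.
    by rewrite addbT.
(* Second case: n is even or D does not contain n+1. Only the blocks of n+1
   can still be affected by the exchange. *)
have P_nat1 l : l < n.+2 -> P (l, true) = ~~ parity_below D l.
  by move=> lt_l; rewrite Pt // par_n2 addbT andbCA; move: no_wrap => /negPf->;
    rewrite andbF addbF.
have f_nat e l : D e -> l < n.+2 -> f e (l, true) = ~~ (e < l).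
  move=> De lt_l; rewrite ft // ?D_lt //;
    case: (eqVneq e n.+1) De no_wrap => [-> -> | _ _ _].
    by rewrite andbT => /negPf->; rewrite addbF.
  by rewrite !andbF addbF.
have [[i [_ lt_i D'i DSi]] | closed] := gap_or_closed 0.
  have lt_i2 := ltnW lt_i.
  apply: (@successor_clash i) => //; rewrite ?(ltn_eqF lt_i) //.
  - rewrite /pivot (ltn_eqF lt_i) /=; case: ifP => // /and3P[odd_n _ le_ni].
    have Di: i = n by apply/eqP; rewrite eqn_leq le_ni -ltnS lt_i.
    by rewrite odd_n -Di DSi in no_wrap.
  - by case: (U i); [rewrite P_nat1 // addbT | rewrite Pf // (ltn_eqF lt_i) andbF].
  - move=> e De; case: (U i); first by rewrite f_nat // addbT.
    by rewrite ff // ?D_lt // (ltn_eqF lt_i) andbF.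
(* Without a gap, D is an initial segment. It is a proper one: if it were the
   whole, n+2 would be odd, so n would be odd too, with n+1 in D. *)
have D0: D 0 by apply: (closed 0 j1).
have [Dn | D'n] := boolP (D n.+1).
  move: par_n2 no_wrap;
    rewrite (@parity_below_all D 0) ?par00 ?Dn ?andbT //= ?negbK => [->//|i lt_i].
  exact: (closed i n.+1).
(* The gap is at n+1. In block (n+1, false) after the exchange, the pivot is 1,
   and 2 belongs to D since D has an odd number of elements. *)
have [/andP[odd_n /negPf Un] | piv] := boolP (odd n && ~~ U n.+1).
  have D1: D 1.
    have [j Dj ne_j0] := two_bits 0; apply: (closed 1 j) => //.
    by rewrite lt0n.
  have D2: D 2.
    apply/negPn/negP=> D'2; move: par_n2.
    rewrite (@parity_below_none D 2) // => [|i /andP[le_2i _]];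
      first by rewrite !par_lt par00 D0 D1.
    by apply: contra D'2; apply: closed.
  have := commons lt_n D'n; rewrite Un /pivot odd_n leqnSn eqxx /= => /(_ 2).
  rewrite Pf // P_nat // ff // ?D_lt // odd_n eqxx D0 !par_lt par00 D0 D1 /=.
  have ->: 2 < n.+1 by rewrite ltn_neqAle -ltnS D_lt // andbT; apply: contraTneq D2 => ->.
  have ->: parity_below D n (+) D n = true by move: par_n2;
    rewrite !par_lt (negPf D'n) addbF.
  move=> clash; suff /clash: leads 1 2 by [].
  split=> //; left; split=> // i /andP[lt_1i]; by rewrite ltnS leqNgt lt_1i.
apply: (@successor_clash n.+1) => //; rewrite ?eqxx //.
- rewrite /pivot eqxx leqnSn andbT; by move: piv => /negPf->.
- move: piv; rewrite negb_and negbK => /orP[/negPf even_n | Un].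
    by case: (U _); [rewrite P_nat1 // addbT | rewrite Pf // even_n].
  by rewrite Un P_nat1 // addbT.
- move=> e De; move: piv; rewrite negb_and negbK => /orP[/negPf even_n | Un].
    case: (U _); first by rewrite f_nat // addbT.
    by rewrite ff // ?D_lt // even_n.
  by rewrite Un f_nat // addbT.
Qed.
End Clash.

(** * The cube is represented *)

Lemma cube_adjP k (u v : k.-tuple bool) :
  reflect (exists2 j, j < k & forall i, i < k -> differ u v i = (i == j)) (cube_adj u v).
Proof.
apply: (iffP cards1P) => [[j Duv] | [j lt_jk d_uv]].
  exists (j : nat) => // i lt_ik; move/setP/(_ (Ordinal lt_ik)): Duv.
  by rewrite !inE !(tnth_nth false).
exists (Ordinal lt_jk); apply/setP => i.
by rewrite !inE !(tnth_nth false) -[LHS]/(differ u v i) d_uv.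
Qed.

Lemma differ_lt k (u v : k.-tuple bool) i : differ u v i -> i < k.
Proof.
by rewrite ltnNge; apply: contraL => le_ki; rewrite /differ !nth_default ?size_tuple.
Qed.

Lemma cube_nonadj k (u v : k.-tuple bool) : u != v -> ~~ cube_adj u v ->
  exists j1 j2, [/\ differ u v j1, differ u v j2 & j1 != j2].
Proof.
move=> ne_uv nonadj.
have [|no_j] := pickP (fun i => tnth u i != tnth v i); last first.
  by case/eqP: ne_uv; apply: eq_from_tnth => i; move/eqP: (no_j i).
move=> j1; rewrite !(tnth_nth false) => d_j1.
have [j2 /andP[d_j2 ne_j]|no_j] := pickP (fun i : 'I_k => differ u v i && (j1 != i)).
  by exists j1, j2; split.
case/cube_adjP: nonadj; exists (j1 : nat) => // i lt_ik; case: eqVneq => [->// | ne_ij].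
by have := no_j (Ordinal lt_ik); rewrite -val_eqE /= eq_sym ne_ij andbT.
Qed.

Lemma priority_full n b : {subset iota 0 n.+2 <= priority n b}.
Proof. by move=> i; rewrite mem_rot. Qed.

Lemma leads_lexle n (first : nat -> bool) p e (u v : n.+2.-tuple bool) : p < n.+2 ->
  leads n (differ u v) p e ->
  lexle first (rot p.+1 (iota 0 n.+2)) u v = (nth false u e == first e).
Proof.
move=> lt_p [d_e lead_e].
have eqn j : ~~ differ u v j -> nth false u j = nth false v j by move/negbNE/eqP.
case: lead_e => [[lt_pe no_d]|[le_ep no_gt no_lt]].
  by apply: lexle_rot_after => // [|j /no_d/eqn//]; rewrite lt_pe (differ_lt d_e).
by apply: lexle_rot_wrap => // [|j /no_gt/eqn//|j /no_lt/eqn//]; rewrite le_ep.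
Qed.

Lemma pivot_lt n b : b.1 < n.+2 -> pivot n b < n.+2.
Proof.
case: b => i c /= lt_i; rewrite /pivot; case: ifP => _; first by case: (i == _).
by case: eqVneq => // ne_i; rewrite ltn_neqAle eqSS ne_i.
Qed.

Lemma cube_nonedge n (u v : n.+2.-tuple bool) j1 j2 :
  differ u v j1 -> differ u v j2 -> j1 != j2 ->
  ~ alternate (cube_word n.+2 (arrangement n) (priority n)) u v.
Proof.
move=> d_j1 d_j2 ne_j.
have ne_uv: u != v by apply: contraTneq d_j1 => ->; rewrite /differ eqxx.
case/(alternate_cube_word (@priority_full n) (uniq_arrangement n) ne_uv) => t fit.
have fit_d e c : differ u v e ->
    t (+) before (differ u v) (arrangement n) (e, c) = (nth false u e != c).
  move=> d_e; have := fit (e, c); rewrite mem_arrangement (differ_lt d_e) /fits /= d_e.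
  by move/(_ isT)/eqP.
apply: (@two_differences_clash n (differ u v) (nth false u)) ne_j => //
  [i|e d_e|i e lt_i d'i lead_e].
- exact: differ_lt.
- apply: (@addbI t); rewrite addbN !fit_d //; by case: nth.
apply: (@addbI t); rewrite addbA (fit_d e) ?(proj1 lead_e) //.
have := fit (i, nth false u i); rewrite mem_arrangement lt_i /fits /= (negPf d'i) eqxx.
move/(_ isT)/eqP->; rewrite /block_le (leads_lexle _ _ lead_e) ?pivot_lt //.
by case: (nth _ u e); case: before.
Qed.

Lemma cube_edge n (u v : n.+2.-tuple bool) :
  cube_adj u v -> alternate (cube_word n.+2 (arrangement n) (priority n)) u v.
Proof.
case/cube_adjP=> j lt_j d_uv.
apply: (cube_edge_alternates (@priority_full n) _ _ _ lt_j d_uv) => [|[i c]|c _].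
- exact: uniq_arrangement.
- by rewrite mem_arrangement.
rewrite beforeE // !parity_below_pred1 ltnn lt_j andbT addFb.
by case: c; case: eqP => [->|_]; rewrite /= ?andbF.
Qed.

Theorem theorem8 (k : nat) (hk : 1 <= k) : representable k (cube k).
Proof.
case: k hk => [|[|n]] // _.
  (* In dimension 1 the word has two blocks of one letter each. *)
  pose bs := [:: (0, false); (0, true)]; pose prio (_ : nat * bool) := iota 0 1.
  exists (cube_word 1 bs prio : seq (cube 1)); split=> [u | u v ne_uv].
    by rewrite count_cube_word /=; case: nth.
  have adj_uv: cube_adj u v.
    by apply: contraT => /(cube_nonadj ne_uv)[[|?] [[|?] [/differ_lt ? /differ_lt ? ?]]].
  split=> // _; case/cube_adjP: adj_uv => j lt_j.
  apply: (@cube_edge_alternates 1 bs prio _ u v j) => // [b|b|c _].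
  - by [].
  - by rewrite !inE => /orP[]/eqP->.
  - by case: j lt_j => // _; rewrite /before /parity; case: c;
      rewrite /= ?big_nil ?big_seq1.
exists (cube_word n.+2 (arrangement n) (priority n) : seq (cube n.+2));
  split=> [u | u v ne_uv].
  by rewrite count_cube_word count_arrangement.
split=> [|alt_uv]; first exact: cube_edge.
apply: contraT => /(cube_nonadj ne_uv)[j1 [j2 [d_j1 d_j2 ne_j]]].
by case: (cube_nonedge d_j1 d_j2 ne_j alt_uv).
Qed.
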